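(* Let $(A,\circ)$ be a Novikov algebra and $(M,\cdot,l_A,r_A)$ an $A$-bimodule Novikov algebra. Let $\delta_+,\delta_-:M\to A$ be two linear maps, $\lambda,\kappa,\mu\in\mathbf k$, and set $\alpha:=\frac{\delta_++\delta_-}{2}$, $\beta:=\frac{\delta_+-\delta_-}{2}$. Define a bilinear operation on $M$ by $$u*v:=l_A(\alpha(u))v+r_A(\alpha(v))u+\lambda\,u\cdot v,\qquad u,v\in M.$$ (i) Suppose that $\alpha$ is an extended $\mathcal O$-operator of weight $\lambda$ with extension $\beta$ of mass $(\kappa,\mu)$ on $(A,\circ)$ associated to $(M,\cdot,l_A,r_A)$. Then $(M,* )$ is a Novikov algebra. (ii) Suppose that $\beta$ is an $A$-bimodule homomorphism from $(M,l_A,r_A)$ to $(A,L_A,R_A)$. Then, for each choice of sign $\pm$ (the same sign on both sides), $\alpha$ satisfies $$\alpha(u)\circ\alpha(v)-\alpha\big(l_A(\alpha(u))v+r_A(\alpha(v))u+\lambda\,u\cdot v\big)=-\beta(u)\circ\beta(v)\pm\lambda\,\beta(u\cdot v),\quad u,v\in M,$$ if and only if $$\delta_\pm(u)\circ\delta_\pm(v)-\delta_\pm(u*v)=0,\quad u,v\in M.$$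
   Context: $\mathbf k$ is a field of characteristic zero; all vector spaces are finite-dimensional over $\mathbf k$. A Novikov algebra $(A,\circ)$ is a vector space with a bilinear operation satisfying $(a\circ b)\circ c-a\circ(b\circ c)=(b\circ a)\circ c-b\circ(a\circ c)$ and $(a\circ b)\circ c=(a\circ c)\circ b$ for all $a,b,c\in A$. Put $L_A(a)b=a\circ b$, $R_A(a)b=b\circ a$. A bimodule of a Novikov algebra $(A,\circ)$ is a triple $(V,l_A,r_A)$ with $V$ a vector space and $l_A,r_A:A\to\mathrm{End}_{\mathbf k}(V)$ linear such that for all $a,b\in A$, $v\in V$: $l_A(a\circ b-b\circ a)v=l_A(a)l_A(b)v-l_A(b)l_A(a)v$; $l_A(a)r_A(b)v-r_A(b)l_A(a)v=r_A(a\circ b)v-r_A(b)r_A(a)v$; $l_A(a\circ b)v=r_A(b)l_A(a)v$; $r_A(a)r_A(b)v=r_A(b)r_A(a)v$. The triple $(A,L_A,R_A)$ is a bimodule of $(A,\circ)$. An $A$-bimodule homomorphism from $(M,l_A,r_A)$ to $(A,L_A,R_A)$ is a linear map $\beta$ with $\beta(l_A(x)u)=x\circ\beta(u)$ and $\beta(r_A(x)u)=\beta(u)\circ x$ for all $x\in A$, $u\in M$. An $A$-bimodule Novikov algebra is a quadruple $(M,\cdot,l_A,r_A)$ where $(M,\cdot)$ is a Novikov algebra, $(M,l_A,r_A)$ is a bimodule of $(A,\circ)$, and for all $a\in A$, $v,w\in M$: $(l_A(a)v)\cdot w-l_A(a)(v\cdot w)=(r_A(a)v)\cdot w-v\cdot(l_A(a)w)$;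 $r_A(a)(v\cdot w)-v\cdot(r_A(a)w)=r_A(a)(w\cdot v)-w\cdot(r_A(a)v)$; $(l_A(a)v)\cdot w=(l_A(a)w)\cdot v$; $r_A(a)(v\cdot w)=(r_A(a)v)\cdot w$. Let $\beta:M\to A$ be linear. $\beta$ is balanced if $l_A(\beta(u))v=r_A(\beta(v))u$ for all $u,v\in M$. $\beta$ is $A$-invariant of mass $\kappa$ if $\kappa\,(x\circ\beta(u))=\kappa\,\beta(l_A(x)u)$ and $\kappa\,(\beta(u)\circ x)=\kappa\,\beta(r_A(x)u)$ for all $x\in A,u\in M$. $\beta$ is equivalent of mass $\mu$ if $\mu\,l_A(\beta(u\cdot v))w=\mu\,(l_A(\beta(u))v)\cdot w$ and $\mu\,r_A(\beta(v\cdot w))u=\mu\,u\cdot(r_A(\beta(w))v)$ for all $u,v,w\in M$. $\alpha$ is an extended $\mathcal O$-operator of weight $\lambda$ with extension $\beta$ of mass $(\kappa,\mu)$ on $(A,\circ)$ associated to $(M,\cdot,l_A,r_A)$ if $\beta$ is balanced, $A$-invariant of mass $\kappa$ and equivalent of mass $\mu$, and for all $u,v\in M$: $\alpha(u)\circ\alpha(v)-\alpha\big(l_A(\alpha(u))v+r_A(\alpha(v))u+\lambda u\cdot v\big)=\kappa\,\beta(u)\circ\beta(v)+\mu\,\beta(u\cdot v)$. *)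

(* Defs.v *)
From mathcomp Require Import all_boot all_order all_algebra.

Set Implicit Arguments.
Unset Strict Implicit.
Unset Printing Implicit Defensive.

Import GRing.Theory.
Local Open Scope ring_scope.

Section Novikov.

Variable K : fieldType.

Record novikov_algebra (A : vectType K) (op : A -> A -> A) : Prop :=
  NovikovAlgebra {
    nov_linear_l : forall b, linear (fun a => op a b);
    nov_linear_r : forall a, linear (op a);
    nov_left_sym : forall a b c,
      op (op a b) c - op a (op b c) = op (op b a) c - op b (op a c);
    nov_right_comm : forall a b c, op (op a b) c = op (op a c) b
  }.

Record novikov_bimodule (A : vectType K) (op : A -> A -> A) (V : vectType K)
    (l r : 'Hom(A, 'End(V))) : Prop :=
  NovikovBimodule {
    bim_ll : forall a b v,
      l (op a b - op b a) v = l a (l b v) - l b (l a v);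
    bim_lr : forall a b v,
      l a (r b v) - r b (l a v) = r (op a b) v - r b (r a v);
    bim_l_op : forall a b v, l (op a b) v = r b (l a v);
    bim_rr : forall a b v, r a (r b v) = r b (r a v)
  }.

Section Operators.

Variables (A M : vectType K).
Variables (op : A -> A -> A) (dot : M -> M -> M).
Variables (l r : 'Hom(A, 'End(M))).

Record bimodule_novikov_algebra : Prop := BimoduleNovikovAlgebra {
  bna_novikov : novikov_algebra dot;
  bna_bimodule : novikov_bimodule op l r;
  bna_left_sym_l : forall a v w,
    dot (l a v) w - l a (dot v w) = dot (r a v) w - dot v (l a w);
  bna_left_sym_r : forall a v w,
    r a (dot v w) - dot v (r a w) = r a (dot w v) - dot w (r a v);
  bna_right_comm_l : forall a v w, dot (l a v) w = dot (l a w) v;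
  bna_right_comm_r : forall a v w, r a (dot v w) = dot (r a v) w
}.

(* The target (A, L_A, R_A) has L_A(x) y = x o y and R_A(x) y = y o x. *)
Definition bimodule_hom_to_regular (beta : 'Hom(M, A)) : Prop :=
  forall x u, beta (l x u) = op x (beta u) /\ beta (r x u) = op (beta u) x.

Definition balanced (beta : 'Hom(M, A)) : Prop :=
  forall u v, l (beta u) v = r (beta v) u.

Definition invariant_of_mass (kappa : K) (beta : 'Hom(M, A)) : Prop :=
  forall x u, kappa *: op x (beta u) = kappa *: beta (l x u)
           /\ kappa *: op (beta u) x = kappa *: beta (r x u).

Definition equivalent_of_mass (mu : K) (beta : 'Hom(M, A)) : Prop :=
  forall u v w,
     mu *: l (beta (dot u v)) w = mu *: dot (l (beta u) v) w
  /\ mu *: r (beta (dot v w)) u = mu *: dot u (r (beta w) v).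

Definition star (alpha : 'Hom(M, A)) (lambda : K) (u v : M) : M :=
  l (alpha u) v + r (alpha v) u + lambda *: dot u v.

Record extended_O_operator (lambda : K) (beta : 'Hom(M, A)) (kappa mu : K)
    (alpha : 'Hom(M, A)) : Prop := ExtendedOOperator {
  eoo_balanced : balanced beta;
  eoo_invariant : invariant_of_mass kappa beta;
  eoo_equivalent : equivalent_of_mass mu beta;
  eoo_eq : forall u v,
    op (alpha u) (alpha v) - alpha (star alpha lambda u v)
      = kappa *: op (beta u) (beta v) + mu *: beta (dot u v)
}.

End Operators.

End Novikov.

(* Main.v *)
(* Write D(u,v) = alpha u o alpha v - alpha (u * v). Expanding either Novikov
   identity for * with D left free, everything not involving D cancels by the
   axioms of an A-bimodule Novikov algebra. When D is given by the extended
   O-operator equation, the remaining terms cancel separately: the kappa terms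
   reduce, through balancedness and invariance, to the bimodule axioms for
   l (beta u), r (beta u), and the mu terms, through balancedness and
   equivalence, to the compatibility of l, r with the product of M. For (ii),
   replacing alpha by alpha + eps beta changes D by
   eps^2 beta u o beta v - eps lambda beta (u . v); take eps = 1, -1. *)
Require Import Defs.
From mathcomp Require Import all_boot all_order all_algebra.
From mathcomp Require Import ring.
Import GRing.Theory.
Local Open Scope ring_scope.

(** * Linearity and module identities *)

Section LinearFunctions.

Context {K : fieldType} {U V : vectType K}.

Lemma linear_funD (f : U -> V) (x y : U) : linear f -> f (x + y) = f x + f y.
Proof. by move=> lf; have := lf 1 x y; rewrite !scale1r. Qed.

Lemma linear_funZ (f : U -> V) (k : K) (x : U) : linear f -> f (k *: x) = k *: f x.
Proof.
move=> lf; have f0 : f 0 = 0.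
  by apply: (addrI (f 0)); rewrite -linear_funD // !addr0.
by have := lf k x 0; rewrite f0 !addr0.
Qed.

Lemma lfun_app_linear (l : 'Hom(U, 'End(V))) (v : V) : linear (fun a => l a v).
Proof. by move=> k a b; rewrite linearP !lfunE /= !lfunE. Qed.

(* [ring] does not decide identities in a module; tested against linear
   functionals, they become identities in K. *)
Lemma eq_linear_functional (x y : V) :
  (forall phi : V -> K, {morph phi : v w / v + w} -> {morph phi : v / - v} ->
     (forall k, {morph phi : v / k *: v >-> k * v}) -> phi x = phi y) ->
  x = y.
Proof.
move=> eq_phi; rewrite (coord_vbasis (memvf x)) (coord_vbasis (memvf y)).
apply: eq_bigr => i _; congr (_ *: _).
by apply: eq_phi => [v w|v|k v]; rewrite (linearD, linearN, linearZ).
Qed.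

(** Derives a goal from a combination of known identities: it remains to check formally that the two
    differences of sides agree. *)
Lemma eq_of_subr_eq (x y a b : V) : x - y = a - b -> a = b -> x = y.
Proof. by move=> eq_xy eq_ab; apply: subr0_eq; rewrite eq_xy eq_ab subrr. Qed.

End LinearFunctions.

Lemma half_sumD {K : fieldType} {V : lmodType K} (x y : V) : 2 != 0 :> K ->
  2^-1 *: (x + y) + 2^-1 *: (x - y) = x.
Proof.
move=> two_neq0; rewrite -scalerDr addrACA subrr addr0 -mulr2n -scaler_nat.
by rewrite scalerA mulVf // scale1r.
Qed.

Lemma half_sumB {K : fieldType} {V : lmodType K} (x y : V) : 2 != 0 :> K ->
  2^-1 *: (x + y) - 2^-1 *: (x - y) = y.
Proof. by move=> two_neq0; rewrite -scalerN opprB (addrC x) half_sumD. Qed.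

(** * The Novikov identities for the star product, up to the defect of [alpha] *)

Section Star.

Context {K : fieldType} {A M : vectType K}.
Variables (op : A -> A -> A) (dot : M -> M -> M) (l r : 'Hom(A, 'End(M))).
Hypothesis bnaM : bimodule_novikov_algebra op dot l r.

Let dotDl u v w : dot (u + v) w = dot u w + dot v w.
Proof. exact: linear_funD (fun x => dot x w) u v (nov_linear_l (bna_novikov bnaM) w). Qed.

Let dotDr u v w : dot w (u + v) = dot w u + dot w v.
Proof. exact: linear_funD (nov_linear_r (bna_novikov bnaM) w). Qed.

Let dotZl k u w : dot (k *: u) w = k *: dot u w.
Proof. exact: linear_funZ (fun x => dot x w) k u (nov_linear_l (bna_novikov bnaM) w). Qed.

Let dotZr k u w : dot w (k *: u) = k *: dot w u.
Proof. exact: linear_funZ (nov_linear_r (bna_novikov bnaM) w). Qed.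

Let appD (f : 'Hom(A, 'End(M))) a b v : f (a + b) v = f a v + f b v.
Proof. exact: linear_funD (fun x => f x v) a b (lfun_app_linear f v). Qed.

Let appZ (f : 'Hom(A, 'End(M))) k a v : f (k *: a) v = k *: f a v.
Proof. exact: linear_funZ (fun x => f x v) k a (lfun_app_linear f v). Qed.

Let appB (f : 'Hom(A, 'End(M))) a b v : f (a - b) v = f a v - f b v.
Proof. by rewrite appD -scaleN1r appZ scaleN1r. Qed.

Let app_argD (f : 'Hom(A, 'End(M))) a u v : f a (u + v) = f a u + f a v.
Proof. exact: linearD. Qed.

Let app_argZ (f : 'Hom(A, 'End(M))) a k u : f a (k *: u) = k *: f a u.
Proof. exact: linearZ. Qed.

Section Defect.

Variables (alpha : 'Hom(M, A)) (lambda : K).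

Local Notation "u ** v" := (star dot l r alpha lambda u v) (at level 40).

Definition star_defect u v : A := op (alpha u) (alpha v) - alpha (u ** v).
Local Notation D := star_defect.

(** Trading [alpha (u ** v)] for [op (alpha u) (alpha v) - D u v] brings the outer action into the
    form that the bimodule axioms treat. *)
Let star_starl u v w : (u ** v) ** w =
  l (op (alpha u) (alpha v) - D u v) w + r (alpha w) (u ** v) + lambda *: dot (u ** v) w.
Proof. by rewrite /D subKr. Qed.

Let star_starr u v w : u ** (v ** w) =
  l (alpha u) (v ** w) + r (op (alpha v) (alpha w) - D v w) u + lambda *: dot u (v ** w).
Proof. by rewrite /D subKr. Qed.

Lemma star_linear_l v : linear (fun u => u ** v).
Proof.
move=> k x y; rewrite /star linearP appD appZ linearP dotDl dotZl.
apply: eq_linear_functional => phi phiD phiN phiZ.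
rewrite !(phiD, phiN, phiZ).
ring.
Qed.

Lemma star_linear_r u : linear (star dot l r alpha lambda u).
Proof.
move=> k x y; rewrite /star linearP (linearP alpha) appD appZ dotDr dotZr.
apply: eq_linear_functional => phi phiD phiN phiZ.
rewrite !(phiD, phiN, phiZ).
ring.
Qed.

Lemma star_left_sym u v w :
  - l (D u v) w + r (D v w) u = - l (D v u) w + r (D u w) v ->
  (u ** v) ** w - u ** (v ** w) = (v ** u) ** w - v ** (u ** w).
Proof.
move=> symD.
have bM := bna_bimodule bnaM; have nM := bna_novikov bnaM.
(* With [D] kept as a symbol, the identity splits by powers of [lambda]: [EA] is the constant part,
   [EM] the linear one, the Novikov axiom of [dot] the quadratic one, and [symD] the rest. *)
have EA := congr2 +%R
  (congr2 (fun x y => x - y) (bim_ll bM (alpha u) (alpha v) w)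
     (bim_lr bM (alpha u) (alpha w) v)) (bim_lr bM (alpha v) (alpha w) u).
have EM := congr2 +%R
  (congr2 (fun x y => x - y) (bna_left_sym_l bnaM (alpha u) v w)
     (bna_left_sym_l bnaM (alpha v) u w)) (bna_left_sym_r bnaM (alpha w) u v).
have E := congr2 +%R (congr2 +%R EA (congr1 ( *:%R lambda) EM))
  (congr2 +%R (congr1 ( *:%R (lambda ^+ 2)) (nov_left_sym nM u v w)) symD).
apply: eq_of_subr_eq E; rewrite !(star_starl, star_starr) /star.
rewrite !(appB, app_argD, app_argZ, dotDl, dotDr, dotZl, dotZr).
apply: eq_linear_functional => phi phiD phiN phiZ.
rewrite !(phiD, phiN, phiZ).
ring.
Qed.

Lemma star_right_comm u v w :
  l (D u v) w = l (D u w) v -> (u ** v) ** w = (u ** w) ** v.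
Proof.
move=> symD.
have bM := bna_bimodule bnaM; have nM := bna_novikov bnaM.
have EA := congr2 +%R
  (congr2 (fun x y => x - y) (bim_l_op bM (alpha u) (alpha v) w)
     (bim_l_op bM (alpha u) (alpha w) v)) (bim_rr bM (alpha w) (alpha v) u).
have EM := congr2 +%R (bna_right_comm_l bnaM (alpha u) v w)
  (congr2 (fun x y => x - y) (bna_right_comm_r bnaM (alpha w) u v)
     (bna_right_comm_r bnaM (alpha v) u w)).
have E := congr2 +%R (congr2 +%R EA (congr1 ( *:%R lambda) EM))
  (congr2 (fun x y => x - y)
     (congr1 ( *:%R (lambda ^+ 2)) (nov_right_comm nM u v w)) symD).
apply: eq_of_subr_eq E; rewrite !star_starl /star.
rewrite !(appB, app_argD, app_argZ, dotDl, dotDr, dotZl, dotZr).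
apply: eq_linear_functional => phi phiD phiN phiZ.
rewrite !(phiD, phiN, phiZ).
ring.
Qed.

End Defect.

(** * Extended O-operators satisfy the defect conditions *)

Lemma extended_O_star_novikov (beta : 'Hom(M, A)) (kappa mu lambda : K)
    (alpha : 'Hom(M, A)) :
  extended_O_operator op dot l r lambda beta kappa mu alpha ->
  novikov_algebra (star dot l r alpha lambda).
Proof.
case=> bal inv equ eqD.
have bM := bna_bimodule bnaM.
have lD u v w : l (star_defect alpha lambda u v) w
    = kappa *: l (op (beta u) (beta v)) w + mu *: dot (l (beta u) v) w.
  by rewrite /star_defect eqD appD !appZ; have [-> _] := equ u v w.
have rD u v w : r (star_defect alpha lambda v w) u
    = kappa *: l (beta u) (l (beta v) w) + mu *: dot u (l (beta v) w).
  (* Invariance puts the [kappa] term in the image of [beta], so that balancedness can turn the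
     right action on [u] into a left action of [beta u]. *)
  rewrite /star_defect eqD appD; have [inv_vw _] := inv (beta v) w.
  rewrite inv_vw !appZ -bal.
  by have [_ ->] := equ u v w; rewrite -bal.
split.
- exact: star_linear_l.
- exact: star_linear_r.
- move=> u v w; apply: star_left_sym; rewrite !lD !rD.
  (* Balancedness makes both sides right actions, [r (beta (dot u w)) v] and [r (beta w) u], as in
     the second equivalence law. *)
  have eq_mu : mu *: l (beta v) (dot u w) = mu *: dot v (l (beta u) w).
    by have [_ eq_vuw] := equ v u w; rewrite !bal.
  have E := congr2 +%R
    (congr2 (fun x y => x - y) eq_mu
       (congr1 ( *:%R kappa) (bim_ll bM (beta u) (beta v) w)))
    (congr1 ( *:%R mu) (bna_left_sym_l bnaM (beta v) u w)).
  apply: eq_of_subr_eq E; rewrite -(bal u v) appB.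
  apply: eq_linear_functional => phi phiD phiN phiZ.
  by rewrite !(phiD, phiN, phiZ); ring.
- move=> u v w; apply: star_right_comm; rewrite !lD.
  congr (_ + _); last by rewrite (bna_right_comm_l bnaM).
  (* The left side becomes [r (beta w) (r (beta v) u)] and the right side
     [r (beta w) (l (beta u) v)]; these agree by balancedness. *)
  have [_ inv_uv] := inv (beta v) u.
  by rewrite -appZ inv_uv appZ bal (bim_l_op bM) -(bal u v).
Qed.

End Star.

(** * Shifting [alpha] by a multiple of a bimodule homomorphism *)

Lemma shifted_star_defect {K : fieldType} {A M : vectType K}
  {op : A -> A -> A} {dot : M -> M -> M} {l r : 'Hom(A, 'End(M))}
  (novA : novikov_algebra op) (alpha beta : 'Hom(M, A)) (lambda eps : K) (u v : M) :
  bimodule_hom_to_regular op l r beta ->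
  let delta := alpha + eps *: beta in
  op (delta u) (delta v) - delta (star dot l r alpha lambda u v)
    = star_defect op dot l r alpha lambda u v
      - (- (eps ^+ 2 *: op (beta u) (beta v)) + eps *: (lambda *: beta (dot u v))).
Proof.
move=> beta_hom delta; rewrite /delta /star_defect.
have opDl x y z := linear_funD (fun x => op x z) x y (nov_linear_l novA z).
have opZl k x z := linear_funZ (fun x => op x z) k x (nov_linear_l novA z).
have opDr z x y := linear_funD (op z) x y (nov_linear_r novA z).
have opZr k z x := linear_funZ (op z) k x (nov_linear_r novA z).
(* The first two terms are the mixed terms of [op (delta u) (delta v)], up to the factor [eps], and
   cancel them. *)
have beta_star : beta (star dot l r alpha lambda u v) =
    op (alpha u) (beta v) + op (beta u) (alpha v) + lambda *: beta (dot u v).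
  rewrite /star !linearD linearZ /=.
  by rewrite (beta_hom _ v).1 (beta_hom _ u).2.
rewrite !(add_lfunE, scale_lfunE) beta_star !(opDl, opDr, opZl, opZr).
apply: eq_linear_functional => phi phiD phiN phiZ.
rewrite !(phiD, phiN, phiZ).
ring.
Qed.

Theorem theorem2p24 (K : fieldType) (charK0 : [pchar K] =i pred0)
  (A M : vectType K) (op : A -> A -> A) (dot : M -> M -> M)
  (l r : 'Hom(A, 'End(M)))
  (novA : novikov_algebra op)
  (bnaM : bimodule_novikov_algebra op dot l r)
  (deltap deltam : 'Hom(M, A)) (lambda kappa mu : K) :
  let alpha : 'Hom(M, A) := 2^-1 *: (deltap + deltam) in
  let beta : 'Hom(M, A) := 2^-1 *: (deltap - deltam) in
  (extended_O_operator op dot l r lambda beta kappa mu alpha ->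
     novikov_algebra (star dot l r alpha lambda))
  /\
  (bimodule_hom_to_regular op l r beta ->
     ((forall u v : M,
         op (alpha u) (alpha v)
           - alpha (l (alpha u) v + r (alpha v) u + lambda *: dot u v)
         = - op (beta u) (beta v) + lambda *: beta (dot u v))
      <->
      (forall u v : M,
         op (deltap u) (deltap v)
           - deltap (star dot l r alpha lambda u v) = 0))
     /\
     ((forall u v : M,
         op (alpha u) (alpha v)
           - alpha (l (alpha u) v + r (alpha v) u + lambda *: dot u v)
         = - op (beta u) (beta v) - lambda *: beta (dot u v))
      <->
      (forall u v : M,
         op (deltam u) (deltam v)
           - deltam (star dot l r alpha lambda u v) = 0))).
Proof.
move=> alpha beta; split; first exact: extended_O_star_novikov.
have two_neq0 : 2 != 0 :> K.
  by have := charK0 2; rewrite !inE /= => /negbT.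
have deltapE : deltap = alpha + beta by rewrite half_sumD.
have deltamE : deltam = alpha - beta by rewrite half_sumB.
rewrite {}deltapE {}deltamE; move: alpha beta => alpha beta hom_beta.
(* The scalars 1 and -1 are exhibited as [eps]; each equivalence then compares an equation with the
   vanishing of the difference of its sides. *)
rewrite -[in alpha + beta](scale1r beta) -[in alpha - beta](scaleN1r beta).
split; split=> eq_uv u v; move: (eq_uv u v);
  rewrite (shifted_star_defect novA _ _ _ _ _ _ hom_beta)
          !(sqrrN, expr1n, scale1r, scaleN1r).
- by move/eqP; rewrite -subr_eq0 => /eqP.
- exact: subr0_eq.
- by move/eqP; rewrite -subr_eq0 => /eqP.
- exact: subr0_eq.
Qed.
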